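(* Let $S$ be a finite tree with at least two vertices. Then $$\lim_{t_{\star} \to \infty} \lim_{n \to \infty} \mathrm{TV}\left( \mathrm{CPA}(n, t_{\star}, S), \mathrm{PA}(n, S)^{\otimes 2} \right) = 1.$$
   Context: Trees are regarded as unlabeled (up to isomorphism); $|S|$ is the number of vertices of $S$. Preferential attachment (PA) trees with seed tree $S$ (with at least two vertices): $T_{|S|} = S$, and given $T_t$, the tree $T_{t+1}$ is obtained by adding one new vertex and one edge joining it to an existing vertex of $T_t$ chosen with probability proportional to its degree in $T_t$. $\mathrm{PA}(n,S)$ denotes the law of the $n$-vertex tree $T_n$. For $t_\star \ge |S|$ and $n \geq t_{\star}$, $\mathrm{CPA}(n, t_{\star}, S)$ is the law of the pair $(T_n^1, T_n^2)$, where $T_t^1 = T_t^2 =: T_t$ for $|S| \leq t \leq t_{\star}$ is grown from $S$ by PA, and conditionally on $T_{t_{\star}}$ the sequences $\{T_t^1\}_{t \geq t_{\star}}$, $\{T_t^2\}_{t \geq t_{\star}}$ are independent PA sequences started from $T_{t_{\star}}$. $\mathrm{PA}(n,S)^{\otimes 2}$ is the law of two independent samples of $\mathrm{PA}(n,S)$. $\mathrm{TV}(P,Q) = \sup_A |P(A) - Q(A)|$; the total variation distance above is non-increasing in $n$, so the inner limit exists. *)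

(* Defs.v *)
From HB Require Import structures.
From mathcomp Require Import all_boot all_order all_algebra.
From mathcomp Require Import all_classical all_reals all_analysis.

Set Implicit Arguments.
Unset Strict Implicit.
Unset Printing Implicit Defensive.

Import Order.TTheory GRing.Theory Num.Theory.
Import numFieldNormedType.Exports.

Local Open Scope set_scope.
Local Open Scope ring_scope.

(* A graph is its set of adjacent ordered pairs; simplicity is part of is_tree. *)
Definition graph (V : finType) : finType := {set V * V}.

Definition adj (V : finType) (G : graph V) : rel V := fun u v => (u, v) \in G.

Definition deg (V : finType) (G : graph V) (v : V) : nat :=
  #|[pred u | adj G v u]|.

Record is_tree (V : finType) (G : graph V) : Prop := IsTree {
  tree_sym : symmetric (adj G);
  tree_irr : irreflexive (adj G);
  tree_connected : forall u v : V, connect (adj G) u v;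
  (* u :: v :: nil is a ucycle as soon as u and v are adjacent; genuine cycles
     are those of length at least 3. *)
  tree_acyclic : forall c : seq V, ucycle (adj G) c -> (size c <= 2)%N
}.

Definition iso (V W : finType) (G : graph V) (H : graph W) : bool :=
  [exists f : {ffun V -> W},
    [&& injectiveb f, #|V| == #|W| &
        [forall u, forall v, adj G u v == adj H (f u) (f v)]]].

(* The unlabeled graph underlying G, for #|V| = n: the set of all its labelings
   by 'I_n. It is empty when #|V| <> n. *)
Definition unlabel (n : nat) (V : finType) (G : graph V) : {set graph 'I_n} :=
  finset (fun H : graph 'I_n => iso G H).

(* V with k more vertices. *)
Fixpoint add_vertices (V : finType) (k : nat) : finType :=
  if k is k'.+1 then option (add_vertices V k') : finType else V.

(* The new vertex None is joined to v. *)
Definition attach (V : finType) (G : graph V) (v : V) : graph (option V) :=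
  finset (fun p : option V * option V =>
    match p with
    | (Some x, Some y) => adj G x y
    | (Some x, None) => x == v
    | (None, Some y) => y == v
    | (None, None) => false
    end).

Section Laws.
Variable R : realType.

(* Laws on finite types are given by their probability mass functions. *)

Definition pa_step (V : finType) (G : graph V) (G' : graph (option V)) : R :=
  \sum_(v : V | attach G v == G') (deg G v)%:R / (\sum_(u : V) deg G u)%:R.

Fixpoint pa_steps (V : finType) (S : graph V) (k : nat) :
    graph (add_vertices V k) -> R :=
  match k return graph (add_vertices V k) -> R with
  | 0 => fun G => (G == S)%:R
  | k'.+1 => fun G' =>
      \sum_(G : graph (add_vertices V k')) pa_steps S G * pa_step G G'
  end.

(* PA(n, S) for #|V| <= n. *)
Definition PA (n : nat) (V : finType) (S : graph V) (c : {set graph 'I_n}) : R :=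
  \sum_(G : graph (add_vertices V (n - #|V|)) | unlabel n G == c) pa_steps S G.

Definition PA2 (n : nat) (V : finType) (S : graph V)
    (c : {set graph 'I_n} * {set graph 'I_n}) : R :=
  PA S c.1 * PA S c.2.

(* CPA(n, t, S) for #|V| <= t <= n: sum over the value T of the common labeled
   tree at time t, which has t vertices. *)
Definition CPA (n t : nat) (V : finType) (S : graph V)
    (c : {set graph 'I_n} * {set graph 'I_n}) : R :=
  \sum_(T : graph (add_vertices V (t - #|V|))) pa_steps S T * (PA T c.1 * PA T c.2).

Definition TV (T : finType) (P Q : T -> R) : R :=
  sup (range (fun A : {set T} => `|\sum_(x in A) P x - \sum_(x in A) Q x|)).

End Laws.

Arguments PA R n {V} S c.
Arguments PA2 R n {V} S c.
Arguments CPA R n t {V} S c.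

(* Main.v *)
Require Import Defs.
From mathcomp Require Import all_boot all_order all_algebra.
From mathcomp Require Import all_classical all_reals all_analysis.
From mathcomp Require Import zify ring lra.
Set Implicit Arguments.
Unset Strict Implicit.
Unset Printing Implicit Defensive.
Import Order.TTheory GRing.Theory Num.Theory numFieldNormedType.Exports.
Local Open Scope classical_set_scope.
Local Open Scope ring_scope.

(** The test that tells the two laws apart compares the sums [Q] of the squared
    degrees of the two trees, which are functions of the unlabeled trees. Let
    [M] be half the sum of all degrees; it grows by one at each step, so it is
    deterministic and comparable to [n].

    In the coupled pair the two values of [Q / M] are close. Choosing a vertex
    of degree [d] raises [Q] by [2 d + 2], and [d] is size-biased, so [Q / M]
    minus a deterministic drift is a martingale. The variance of its later
    increments is controlled by the sum of the cubed degrees, whose mean is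
    [O(M ^ (3 / 2))]: a nonnegative correction term of this size turns the
    square into a supermartingale ([step_square_slack]). Hence both trees stay
    near a common value determined at time [t], up to an error whose mean
    square is [O(t ^ (-1 / 2))] ([concentration], [expect_slack]).

    In the independent pair they are not, because [Q / M] has no atoms in the
    limit. Fix two vertices of the seed, of degrees [x] and [y] at a later time,
    with sum [D]. Conditionally on everything except which of the two received
    each of the vertices attached to either, [x] is the content of a Polya urn,
    so it takes each value with probability [O(1 / D)] ([head_value_le]), while
    [Q] is a quadratic polynomial in [x] that falls in a window of half-width
    [w] for at most [2 (sqrt w + 1)] values of [x] ([count_sum_squares]). The
    mean of [1 / (D - 1)] is [O(n ^ (-1 / 2))] ([expect_inv_heads]), so
    [Q] falls in a given window of half-width [e ^ 2 M] with probability
    [O(e + n ^ (-1 / 2))] ([anticoncentration]).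

    Testing whether the two values of [Q] differ by at most [e ^ 2 M] thus gives
    a total variation distance of at least
    [1 - O(e ^ (-4) t ^ (-1 / 2)) - O(e + n ^ (-1 / 2))] ([TV_CPA_ge]); let [n],
    then [t], go to infinity and then [e] to zero. The limit in [n] exists
    because a step of preferential attachment acts on unlabeled trees as a
    Markov kernel, and kernels contract total variation ([TV_CPA_succ]). *)

(** * The degree sequence as a Markov chain on lists *)

(** Degrees in order of birth: the chosen vertex gains a neighbor, and the
    newborn one has degree 1. *)
Definition grow (l : seq nat) (i : nat) : seq nat := rcons (incr_nth l i) 1%N.

Lemma sumn_grow l i : (i < size l)%N -> sumn (grow l i) = (sumn l + 2)%N.
Proof.
rewrite sumn_rcons => il; rewrite [RHS]addn2 addn1; congr _.+1.
by elim: l i il => [|x l IHl] [|i] //= il; rewrite IHl // addnS.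
Qed.

(** The lists that [k] steps may produce, those of weight zero included. The
    first step is peeled off, to match the recursion of [expect]. *)
Fixpoint reachable (k : nat) (l z : seq nat) : Prop :=
  if k is k'.+1 then exists2 i, (i < size l)%N & reachable k' (grow l i) z
  else z = l.

Lemma reachable_sumn k l z :
  reachable k l z -> sumn z = (sumn l + k.*2)%N.
Proof.
elim: k l => [|k IHk] l /= => [-> | [i il /IHk ->]]; first by rewrite addn0.
by rewrite sumn_grow // doubleS -addnA.
Qed.

Lemma reachable_cons2 k x y l z : (0 < x)%N -> (0 < y)%N ->
  reachable k [:: x, y & l] z ->
  exists x' y' l', [/\ z = [:: x', y' & l'], (0 < x')%N & (0 < y')%N].
Proof.
elim: k x y l => [|k IHk] x y l x0 y0 /=; first by move=> ->; exists x, y, l.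
by case=> -[|[|i]] _; apply: IHk.
Qed.

(** * Transition operator and its means *)

Section Expectation.
Variable R : realFieldType.
Implicit Types (h g : seq nat -> R) (l z : seq nat) (k : nat) (f : nat -> R).

(** One step of the transition operator: entry [i] is chosen with probability
    proportional to its value. The law after [k] steps is handled as a
    linear functional, through the iterates of this operator. *)
Definition step h l : R :=
  \sum_(i < size l) (nth 0%N l i)%:R / (sumn l)%:R * h (grow l i).

Definition expect k h : seq nat -> R := iter k step h.

Definition entry_sum f l : R := \sum_(x <- l) f x.

Lemma expectS k h l : expect k.+1 h l = step (expect k h) l.
Proof. by []. Qed.

Lemma expectSr k h l : expect k.+1 h l = expect k (step h) l.
Proof. by rewrite /expect iterSr. Qed.

Lemma le_expect k h g l : (forall z, reachable k l z -> h z <= g z) ->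
  expect k h l <= expect k g l.
Proof.
elim: k l => [|k IHk] l hg; first exact: hg.
apply: ler_sum => i _; apply: ler_wpM2l; first by rewrite divr_ge0.
by apply: IHk => z ?; apply: hg; exists (i : nat).
Qed.

Lemma eq_expect k h g l : (forall z, reachable k l z -> h z = g z) ->
  expect k h l = expect k g l.
Proof.
by move=> hg; apply/eqP; rewrite eq_le !le_expect // => z /hg ->.
Qed.

Lemma expectD k h g l :
  expect k (fun z => h z + g z) l = expect k h l + expect k g l.
Proof.
elim: k l => [|k IHk] l //; rewrite !expectS /step -big_split /=.
by apply: eq_bigr => i _; rewrite -mulrDr -IHk.
Qed.

Lemma expectZ k c h l : expect k (fun z => c * h z) l = c * expect k h l.
Proof.
elim: k l => [|k IHk] l //; rewrite !expectS /step mulr_sumr.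
by apply: eq_bigr => i _; rewrite mulrCA -IHk.
Qed.

Lemma expect_sum k n (h : nat -> seq nat -> R) l :
  expect k (fun z => \sum_(a < n) h a z) l = \sum_(a < n) expect k (h a) l.
Proof.
elim: n => [|n IHn].
  rewrite big_ord0 -[RHS](mul0r (expect k (fun=> 0) l)) -expectZ.
  by apply: eq_expect => z _; rewrite big_ord0 mul0r.
rewrite big_ord_recr /= -IHn -expectD.
by apply: eq_expect => z _; rewrite big_ord_recr.
Qed.

Lemma sumr_nth l f : \sum_(i < size l) f (nth 0%N l i) = entry_sum f l.
Proof. by rewrite /entry_sum (big_nth 0%N) big_mkord. Qed.

Lemma entry_sum_nat l : entry_sum (fun x => x%:R) l = (sumn l)%:R.
Proof. by rewrite /entry_sum sumnE natr_sum. Qed.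

(** The size-biased mean: a function of the chosen entry is averaged with the
    entries themselves as weights. *)
Lemma step_nth h f l : (forall i, (i < size l)%N -> h (grow l i) = f (nth 0%N l i)) ->
  step h l = entry_sum (fun x => x%:R * f x) l / (sumn l)%:R.
Proof.
move=> hf; rewrite -sumr_nth mulr_suml; apply: eq_bigr => i _.
by rewrite hf // mulrAC.
Qed.

Lemma expect_cst k c l : (0 < sumn l)%N -> expect k (fun=> c) l = c.
Proof.
elim: k l => [|k IHk] l l0 //; rewrite expectS.
rewrite (@step_nth _ (fun=> c)) => [|i il]; last by rewrite IHk // sumn_grow ?addn2.
rewrite /entry_sum -mulr_suml -/(entry_sum _ _) entry_sum_nat mulrAC divff ?mul1r //.
by rewrite pnatr_eq0 -lt0n.
Qed.

Lemma entry_sum_grow f l i : (i < size l)%N ->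
  entry_sum f (grow l i) = entry_sum f l + f (nth 0%N l i).+1 - f (nth 0%N l i) + f 1%N.
Proof.
move=> il; rewrite /entry_sum /grow -cats1 big_cat big_seq1; congr (_ + _).
elim: l i il => [|x l IHl] [|i] //= il; rewrite !big_cons /= ?IHl //; ring.
Qed.

Lemma step_cons2 h x y l : step h [:: x, y & l] =
  x%:R / (x + y + sumn l)%:R * h [:: x.+1, y & rcons l 1%N] +
  y%:R / (x + y + sumn l)%:R * h [:: x, y.+1 & rcons l 1%N] +
  \sum_(i < size l) (nth 0%N l i)%:R / (x + y + sumn l)%:R * h [:: x, y & grow l i].
Proof. by rewrite /step !big_ord_recl /= !addnA addrA. Qed.

(** The number of edges, when [l] is the degree sequence of a graph. *)
Definition mass l : R := (sumn l)%:R / 2.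

Lemma mass_grow l i : (i < size l)%N -> mass (grow l i) = mass l + 1.
Proof. by move=> il; rewrite /mass sumn_grow // natrD; field. Qed.

Lemma mass_reachable k l z : reachable k l z -> mass z = mass l + k%:R.
Proof. by move/reachable_sumn; rewrite /mass => ->; rewrite -muln2 natrD natrM; field. Qed.

Lemma mass_gt0 l : (0 < sumn l)%N -> 0 < mass l.
Proof. by move=> l0; rewrite divr_gt0 ?ltr0n. Qed.

Definition squares : seq nat -> R := entry_sum (fun d => d%:R ^+ 2).

(** Rising factorials replace cubes because their mean increments close up into
    a linear recursion, see [step_potential]. *)
Definition cubes : seq nat -> R := entry_sum (fun d => (d * d.+1 * d.+2)%:R).

Lemma squares_grow l i : (i < size l)%N ->
  squares (grow l i) = squares l + 2 * (nth 0%N l i)%:R + 2.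
Proof. by move=> il; rewrite /squares entry_sum_grow // -natr1; ring. Qed.

Lemma cubes_grow l i : (i < size l)%N -> cubes (grow l i) =
  cubes l + 3 * ((nth 0%N l i).+1 * (nth 0%N l i).+2)%:R + 6.
Proof. by move=> il; rewrite /cubes entry_sum_grow // !natrM -!natr1; ring. Qed.

Lemma entry_sumD f (g : nat -> R) l :
  entry_sum (fun x => f x + g x) l = entry_sum f l + entry_sum g l.
Proof. exact: big_split. Qed.

Lemma entry_sumZ c f l : entry_sum (fun x => c * f x) l = c * entry_sum f l.
Proof. by rewrite /entry_sum mulr_sumr. Qed.

(** The term [12 * mass l] absorbs the contribution 6 of the newborn vertex, so
    that the mean evolves by a pure factor. *)
Definition potential l : R := cubes l + 12 * mass l.

Lemma cubes_ge0 l : 0 <= cubes l.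
Proof. exact: sumr_ge0. Qed.

Lemma step_potential l : (0 < sumn l)%N ->
  step potential l = (1 + 3 / (2 * mass l)) * potential l.
Proof.
move=> l0; have M0 := mass_gt0 l0; have sE : (sumn l)%:R = 2 * mass l by rewrite /mass; field.
rewrite (@step_nth _ (fun d => (potential l + 18) + 3 * (d.+1 * d.+2)%:R)); last first.
  by move=> i il; rewrite /potential cubes_grow // mass_grow //; ring.
rewrite (_ : entry_sum _ l = (potential l + 18) * (sumn l)%:R + 3 * cubes l).
  by rewrite sE /potential; field; rewrite gt_eqF.
rewrite -entry_sum_nat /cubes -!entry_sumZ -entry_sumD; apply: eq_bigr => d _.
by rewrite !natrM; ring.
Qed.

(** Bound on the total variance that [squares / mass] will still accumulate. *)
Definition slack l : R := 4 * potential l / mass l ^+ 2.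

Lemma step_slack l : (0 < sumn l)%N -> step slack l =
  4 * ((1 + 3 / (2 * mass l)) * potential l) / (mass l + 1) ^+ 2.
Proof.
move=> l0; rewrite -step_potential //.
rewrite -[LHS]/(expect 1 _ l) -[step _ l]/(expect 1 _ l) mulrAC -expectZ.
by apply: eq_expect => z /mass_reachable Mz; rewrite /slack Mz mulrAC.
Qed.

(** The increment of [squares / mass], once recentered by [2 / (mass + 1)], has
    mean zero, because [2 d] has size-biased mean [squares / mass]; its variance
    is at most [2 cubes / (mass (mass + 1) ^ 2)], and the slack decreases by at
    least that much in mean. *)
Lemma step_square_slack b l : (0 < sumn l)%N ->
  step (fun z => (squares z / mass z - (b + 2 / (mass l + 1))) ^+ 2 + slack z) l
    <= (squares l / mass l - b) ^+ 2 + slack l.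
Proof.
move=> l0; have M0 := mass_gt0 l0; have sE : (sumn l)%:R = 2 * mass l by rewrite /mass; field.
have M1 : mass l + 1 != 0 by rewrite gt_eqF // addr_gt0.
have Mn : mass l != 0 by rewrite gt_eqF.
rewrite -[step _ l]/(expect 1 _ l) expectD.
rewrite /= step_slack // (@step_nth _ (fun d => ((squares l + 2 * d%:R) / (mass l + 1) - b) ^+ 2));
  last by move=> i il; rewrite squares_grow // mass_grow //; congr (_ ^+ 2); field.
pose c := squares l / (mass l + 1) - b; pose e : R := 2 / (mass l + 1).
pose T := entry_sum (fun d => d%:R ^+ 3) l.
rewrite (_ : entry_sum _ l = c ^+ 2 * (sumn l)%:R + 2 * c * e * squares l + e ^+ 2 * T); last first.
  rewrite -entry_sum_nat /squares /T -!entry_sumZ -!entry_sumD; apply: eq_bigr => d _.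
  by rewrite /c /e /squares; field.
have TC : T <= cubes l.
  apply: ler_sum => d _; rewrite -natrX ler_nat !expnS expn0 muln1 mulnA.
  by rewrite !leq_mul ?leqnSn // ltnW.
have T0 : 0 <= T by apply: sumr_ge0 => d _; rewrite exprn_ge0.
(* The drop of the slack pays for the variance with the three nonnegative
   terms below to spare. *)
rewrite sE -subr_ge0.
set M := mass l in M0 M1 Mn *; set Q := squares l in c *.
rewrite (_ : _ - _ = (Q / M) ^+ 2 / (M + 1) ^+ 2
   + 2 * (cubes l - T) / (M * (M + 1) ^+ 2)
   + (4 * cubes l / (M * (M + 1)) ^+ 2 + 12 * (2 * M + 4) / (M * (M + 1) ^+ 2))).
  have C0 := cubes_ge0 l; have {}M0 := ltW M0.
  have TC0 : 0 <= cubes l - T by rewrite subr_ge0.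
  by do ?[exact: TC0 | exact: sqr_ge0 | apply: addr_ge0 | apply: divr_ge0 | apply: mulr_ge0].
rewrite /slack /potential /c /e -/M; field.
by rewrite M1 Mn.
Qed.

End Expectation.

(** * Concentration of the sum of squares *)

Section Concentration.
Variable R : realFieldType.
Implicit Types (h g : seq nat -> R) (l z : seq nat) (k : nat).

Definition drift (m : R) k : R := \sum_(j < k) 2 / (m + j.+1%:R).

Lemma expect_square_slack k b l : (0 < sumn l)%N ->
  expect k (fun z => (squares R z / mass R z - (b + drift (mass R l) k)) ^+ 2 + slack R z) l
    <= (squares R l / mass R l - b) ^+ 2 + slack R l.
Proof.
elim: k b l => [|k IHk] b l l0; first by rewrite /drift big_ord0 addr0.
apply: le_trans (step_square_slack b l0); rewrite expectS.
apply: (@le_expect R 1) => z lz.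
have z0 : (0 < sumn z)%N by rewrite (reachable_sumn lz) addn_gt0 l0.
apply: le_trans (IHk _ _ z0); rewrite le_eqVlt; apply/orP; left; apply/eqP.
apply: eq_expect => y _; congr ((_ - _) ^+ 2 + _).
rewrite -addrA /drift big_ord_recl (mass_reachable R lz); congr (_ + (_ + _)).
by apply: eq_bigr => j _; rewrite -addrA -natrD.
Qed.

Lemma potential_ge0 l : 0 <= potential R l.
Proof. by rewrite addr_ge0 ?cubes_ge0 // mulr_ge0 // divr_ge0. Qed.

Lemma slack_ge0 l : 0 <= slack R l.
Proof. by rewrite divr_ge0 ?sqr_ge0 // mulr_ge0 ?potential_ge0. Qed.

(** The center is the conditional mean given [l], so two runs started from [l]
    share it. *)
Lemma concentration k l : (0 < sumn l)%N ->
  exists c, expect k (fun z => (squares R z / mass R z - c) ^+ 2) l <= slack R l.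
Proof.
move=> l0; exists (squares R l / mass R l + drift (mass R l) k).
have := expect_square_slack k (squares R l / mass R l) l0.
rewrite subrr expr0n /= add0r; apply: le_trans.
by apply: le_expect => z lz; rewrite lerDl slack_ge0.
Qed.

End Concentration.

(** * Decay of means at the rate of an inverse square root *)

Section Decay.
Variable R : rcfType.
Implicit Types (h g : seq nat -> R) (l z : seq nat) (k : nat).

(** If one step multiplies the mean of [h] by at most
    [sqrt (mass / (mass + 1))], these factors telescope. *)
Lemma expect_decay k h l :
  (forall j z, reachable j l z ->
     step h z * Num.sqrt (mass R z + 1) <= h z * Num.sqrt (mass R z)) ->
  expect k h l * Num.sqrt (mass R l + k%:R) <= h l * Num.sqrt (mass R l).
Proof.
move=> hstep; elim: k => [|k IHk]; first by rewrite addr0.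
apply: le_trans IHk; rewrite expectSr mulrC [leRHS]mulrC -!expectZ.
apply: le_expect => z lz; rewrite -(mass_reachable R lz) -natr1 addrA.
by rewrite -(mass_reachable R lz) mulrC [leRHS]mulrC; apply: hstep lz.
Qed.

Lemma mul_sqrt_le (a b x y : R) : 0 <= a -> 0 <= b -> 0 <= x -> 0 <= y ->
  a ^+ 2 * x <= b ^+ 2 * y -> a * Num.sqrt x <= b * Num.sqrt y.
Proof.
move=> a0 b0 x0 y0 abxy.
rewrite -(@ler_pXn2r _ 2) ?nnegrE ?mulr_ge0 ?sqrtr_ge0 //.
by rewrite !exprMn !sqr_sqrtr.
Qed.

(** The mean of [cubes] grows at most like [mass ^ (3 / 2)], half a power less than
    the denominator of the slack. *)
Lemma expect_slack k l : (0 < sumn l)%N ->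
  expect k (slack R) l * Num.sqrt (mass R l + k%:R) <= slack R l * Num.sqrt (mass R l).
Proof.
move=> l0; apply: expect_decay => j z lz.
have z0 : (0 < sumn z)%N by rewrite (reachable_sumn lz) addn_gt0 l0.
have M0 := mass_gt0 R z0.
have P0 := potential_ge0 R z.
rewrite step_slack // /slack; move: (mass R z) (potential R z) M0 P0 => M P M0 P0.
have -> : 4 * ((1 + 3 / (2 * M)) * P) / (M + 1) ^+ 2 =
          4 * P / (M * (M + 1)) ^+ 2 * (M * (M + 3 / 2)).
  by field; rewrite !gt_eqF // addr_gt0.
have -> : 4 * P / M ^+ 2 = 4 * P / (M * (M + 1)) ^+ 2 * (M + 1) ^+ 2.
  by field; rewrite !gt_eqF // addr_gt0.
rewrite -mulrA -[leRHS]mulrA; apply: ler_wpM2l.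
  by rewrite divr_ge0 ?sqr_ge0 // mulr_ge0.
apply: mul_sqrt_le; [nra|nra|nra|exact: ltW|].
by rewrite -subr_ge0 [X in 0 <= X](_ : _ = (M + 1) * M * (3 / 4 * M + 1)); [nra|field].
Qed.

End Decay.

(** * Anticoncentration of the sum of squares *)

Section Anticoncentration.
Variable R : rcfType.
Implicit Types (l z : seq nat) (k : nat).

(** The two oldest entries play the role of the two seed vertices whose degrees
    form a Polya urn. *)
Definition on_heads (F : nat -> nat -> seq nat -> R) z : R :=
  if z is [:: x, y & l] then F x y l else 0.

(** The probability that the first entry equals [a], conditionally on the sum [D]
    of the first two entries and on all others, is at most
    [(x0 + y0 - 1) / (D - 1)]; the test function [g] plays the role of the
    conditioning. When the urn is hit, the value [a] is reached from [a - 1] with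
    weight [a - 1] and kept with weight [D - a]; these weights sum to [D - 1] out
    of [D], so the bound [1 / (D - 1)] becomes [1 / D]. *)
Lemma head_value_le k x0 y0 l0 a (g : nat -> seq nat -> R) :
  (0 < x0)%N -> (0 < y0)%N -> (forall D l, 0 <= g D l) ->
  expect k (on_heads (fun x y l => (x == a)%:R * g (x + y)%N l)) [:: x0, y0 & l0]
  <= expect k (on_heads (fun x y l =>
       (x0 + y0).-1%:R / (x + y).-1%:R * g (x + y)%N l)) [:: x0, y0 & l0].
Proof.
move=> x0_gt0 y0_gt0; elim: k a g => [|k IHk] a g g0.
  rewrite /= divff ?ler_wpM2r //.
    by rewrite lern1 leq_b1.
  by rewrite pnatr_eq0; lia.
pose g1 D l : R := \sum_(i < size l) (nth 0%N l i)%:R / (D + sumn l)%:R * g D (grow l i).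
pose g2 D l : R := g D.+1 (rcons l 1%N) / (D + sumn l)%:R.
have g10 D l : 0 <= g1 D l.
  by apply: sumr_ge0 => i _; rewrite mulr_ge0 // divr_ge0.
have g20 D l : 0 <= g2 D l by rewrite divr_ge0.
(* Both entries are positive, so [a] is attained only if [0 < a <= D]; keeping
   this indicator is what bounds the truncated weights by [D - 1]. *)
pose c D : R := (0 < a <= D)%:R * a.-1%:R.
pose d D : R := (0 < a <= D)%:R * (D - a)%:R.
have c0 D l : 0 <= c D * g2 D l by apply: mulr_ge0 => //; apply: mulr_ge0.
have d0 D l : 0 <= d D * g2 D l + g1 D l.
  by apply: addr_ge0 => //; apply: mulr_ge0 => //; apply: mulr_ge0.
rewrite !expectSr.
apply: (@le_trans _ _ (expect k (fun z =>
    on_heads (fun x y l => (x == a.-1)%:R * (c (x + y)%N * g2 (x + y)%N l)) z +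
    on_heads (fun x y l => (x == a)%:R * (d (x + y)%N * g2 (x + y)%N l + g1 (x + y)%N l)) z)
    [:: x0, y0 & l0])).
  apply: le_expect => z /(reachable_cons2 x0_gt0 y0_gt0)[x [y [l [-> x_gt0 y_gt0]]]].
  rewrite step_cons2 /= addSn addnS /g2.
  rewrite (_ : \sum_(i < _) _ = (x == a)%:R * g1 (x + y)%N l); last first.
    by rewrite mulr_sumr; apply: eq_bigr => i _; rewrite mulrCA.
  rewrite mulrDr addrA lerD2r /c /d.
  set t := (x + y + sumn l)%:R; set G := g _ _.
  rewrite (_ : _ + _ = (x%:R * (x.+1 == a)%:R + y%:R * (x == a)%:R) * (G / t)); last by ring.
  rewrite (_ : (x == a.-1)%:R * _ + _ = ((x == a.-1)%:R * ((0 < a <= x + y)%N%:R * a.-1%:R)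
     + (x == a)%:R * ((0 < a <= x + y)%N%:R * (x + y - a)%:R)) * (G / t)); last by ring.
  apply: ler_wpM2r; first by rewrite divr_ge0 ?g0.
  case: a {c d c0 d0} => [|a]; first by rewrite (gtn_eqF x_gt0) /= !mulr0n !(mulr0, mul0r, addr0).
  rewrite eqSS; have [->|xa] := eqVneq x a.
    rewrite (_ : (a < a + y)%N = true); last by lia.
    by rewrite (ltn_eqF (ltnSn a)) /= !mulr0 !mul0r !mul1r mulr1.
  have [->|_] := eqVneq x a.+1; last by rewrite !mulr0 !mul0r addr0.
  by rewrite leq_addr addKn /= mulr0 mul0r !mul1r mulr1.
rewrite expectD.
apply: le_trans (lerD (IHk _ _ c0) (IHk _ _ d0)) _.
rewrite -expectD; apply: le_expect => z.
move=> /(reachable_cons2 x0_gt0 y0_gt0)[x [y [l [-> x_gt0 y_gt0]]]].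
rewrite step_cons2 /= addSn addnS /=.
set s := (x0 + y0).-1%:R; set D := (x + y)%N.
have D1 : D.-1%:R = D%:R - 1 :> R by rewrite -subn1 natrB // /D addn_gt0 x_gt0.
have D_gt1 : (1 < D)%N by rewrite /D; lia.
have D2 : D.-1%:R != 0 :> R by rewrite pnatr_eq0; lia.
have D3 : D%:R != 0 :> R by rewrite pnatr_eq0; lia.
rewrite (_ : \sum_(i < _) _ = s / D.-1%:R * g1 D l); last first.
  by rewrite mulr_sumr; apply: eq_bigr => i _; rewrite mulrCA.
rewrite mulrDr addrA lerD2r /g2.
have t0 : (D + sumn l)%:R != 0 :> R by rewrite pnatr_eq0; lia.
set t := (D + sumn l)%:R in t0 *; set G := g _ _.
rewrite (_ : _ + _ = (c D + d D) * (s / D.-1%:R * (G / t))); last by ring.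
have DE : x%:R = D%:R - y%:R :> R by rewrite /D natrD addrK.
rewrite [leRHS](_ : _ = D.-1%:R * (s / D.-1%:R * (G / t))); last first.
  by rewrite DE D1; field; move: t0; rewrite /t natrD -D1 D2 D3 => ->.
apply: ler_wpM2r; first by rewrite mulr_ge0 // divr_ge0 ?g0.
rewrite /c /d -mulrDr -natrD -natrM ler_nat.
by case: andP => [[a0 aD]|_]; lia.
Qed.

(** The values lie between the least and the greatest element of [B]. *)
Lemma card_diameter N (B : {set 'I_N}) (r : R) : 0 <= r ->
  (forall a b, a \in B -> b \in B -> (b <= a)%N -> a%:R - b%:R <= r) ->
  #|B|%:R <= r + 1.
Proof.
move=> r0 Br; have [->|[b0 b0B]] := set_0Vmem B; first by rewrite cards0 addr_ge0.
have [b bB bmin] := @arg_minnP _ b0 (mem B) val b0B.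
have [c cB cmax] := @arg_maxnP _ b0 (mem B) val b0B.
have bc : (b <= c)%N by apply: bmin.
apply: (@le_trans _ _ (c - b).+1%:R); last first.
  by rewrite -natr1 natrB // lerD2r; apply: Br.
have inj : {in B &, injective (fun a : 'I_N => inord (a - b) : 'I_(c - b).+1)}.
  move=> x y xB yB /(congr1 val) /=.
  have := (bmin _ xB, bmin _ yB, cmax _ xB, cmax _ yB).
  case=> [[[bx by_] xc] yc]; rewrite !inordK ?ltnS ?leq_sub2r // => xy.
  by apply: val_inj; rewrite /= -(subnK bx) xy subnK.
rewrite ler_nat -(card_in_imset inj) -[leqRHS]card_ord; exact: max_card.
Qed.

(** Two solutions [a], [b] on the same side of [D / 2] satisfy
    [(a - b) ^ 2 <= |(a - b) (a + b - D)| <= w], so each side contributes at most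
    [sqrt w + 1] of them. *)
Lemma count_sum_squares N (D : nat) (q w : R) : 0 <= w ->
  \sum_(a < N) (`|a%:R ^+ 2 + (D%:R - a%:R) ^+ 2 - q| <= w)%R%:R <= 2 * (Num.sqrt w + 1) :> R.
Proof.
move=> w0; pose B := [set a : 'I_N | `|a%:R ^+ 2 + (D%:R - a%:R) ^+ 2 - q| <= w]%SET.
pose H := [set a : 'I_N | (D <= a.*2)%N]%SET.
rewrite (_ : \sum_(a < N) _ = #|B|%:R); last first.
  by rewrite -sum1_card natr_sum [RHS]big_mkcond; apply: eq_bigr => a _; rewrite inE; case: ifP.
have BP a b : a \in B -> b \in B ->
    `|(a%:R - b%:R) * (a%:R + b%:R - D%:R)| <= w :> R.
  rewrite !inE !ler_norml => /andP[a1 a2] /andP[b1 b2]; apply/andP; split; lra.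
have sq (u v : R) : 0 <= u -> 0 <= v -> u <= v -> `|u * v| <= w -> u <= Num.sqrt w.
  move=> u0 v0 uv; rewrite ger0_norm ?mulr_ge0 // => uvw.
  rewrite -[u]ger0_norm // -sqrtr_sqr ler_wsqrtr // (le_trans _ uvw) //.
  by rewrite expr2 ler_wpM2l.
rewrite -(cardsID H B) natrD mulrDl !mul1r lerD //.
  apply: card_diameter; first exact: sqrtr_ge0.
  move=> a b /setIP[aB]; rewrite inE => aH /setIP[bB]; rewrite inE => bH ba.
  have [{}aH {}bH {}ba] : [/\ D%:R <= 2 * a%:R :> R, D%:R <= 2 * b%:R :> R & b%:R <= a%:R :> R].
    by rewrite -!natrM !ler_nat !mul2n.
  apply: sq (BP _ _ aB bB); lra.
apply: card_diameter; first exact: sqrtr_ge0.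
move=> a b /setDP[aB]; rewrite inE -ltnNge => aH /setDP[bB]; rewrite inE -ltnNge => bH ba.
have [{}aH {}bH {}ba] : [/\ 2 * a%:R <= D%:R :> R, 2 * b%:R <= D%:R :> R & b%:R <= a%:R :> R].
  by rewrite -!natrM !ler_nat !mul2n (ltnW aH) (ltnW bH).
have ba0 : 0 <= a%:R - b%:R :> R by rewrite subr_ge0.
have Dab : a%:R - b%:R <= D%:R - a%:R - b%:R :> R by lra.
apply: sq ba0 (le_trans ba0 Dab) Dab _.
by rewrite -normrN -mulrN (_ : - (D%:R - a%:R - b%:R) = a%:R + b%:R - D%:R) ?BP //; ring.
Qed.

(** Summing [head_value_le] over the admissible values [a] of the first entry:
    once the sum [D] and the other entries are given, the sum of squares is
    [a ^ 2 + (D - a) ^ 2] plus a known term. *)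
Lemma anticoncentration k x0 y0 l0 (q w : R) : (0 < x0)%N -> (0 < y0)%N -> 0 <= w ->
  expect k (fun z => (`|squares R z - q| <= w)%R%:R) [:: x0, y0 & l0] <=
  2 * (Num.sqrt w + 1) * (x0 + y0).-1%:R *
    expect k (on_heads (fun x y _ => (x + y).-1%:R^-1)) [:: x0, y0 & l0].
Proof.
move=> x0_gt0 y0_gt0 w0; pose N := (sumn [:: x0, y0 & l0] + k.*2).+1.
pose g a D l : R := (`|a%:R ^+ 2 + (D%:R - a%:R) ^+ 2 - (q - squares R l)| <= w)%R%:R.
have squares_cons2 x y l : squares R [:: x, y & l] = x%:R ^+ 2 + y%:R ^+ 2 + squares R l.
  by rewrite /squares /entry_sum !big_cons addrA.
apply: (@le_trans _ _ (\sum_(a < N) expect k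
    (on_heads (fun x y l => (x == a)%:R * g a (x + y)%N l)) [:: x0, y0 & l0])).
  rewrite -(expect_sum k N (fun a => on_heads (fun x y l => (x == a)%:R * g a (x + y)%N l))).
  apply: le_expect => z lz.
  have := reachable_sumn lz.
  have [x [y [l [-> x_gt0 y_gt0]]]] := reachable_cons2 x0_gt0 y0_gt0 lz.
  rewrite [sumn (x :: _)]/= => sz.
  have xN : (x < N)%N by rewrite /N ltnS -sz leq_addr.
  rewrite (bigD1 (Ordinal xN)) //= big1 => [|a]; last first.
    by rewrite -val_eqE /= eq_sym => /negPf ->; rewrite mul0r.
  rewrite eqxx mul1r addr0 /g squares_cons2 natrD [x%:R + y%:R]addrC addrK.
  by rewrite (_ : _ - (q - _) = x%:R ^+ 2 + y%:R ^+ 2 + squares R l - q) //; ring.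
apply: le_trans (ler_sum _ (fun (a : 'I_N) _ =>
  head_value_le k l0 a x0_gt0 y0_gt0 (g := g a) (fun _ _ => ler0n _ _))) _.
rewrite -(expect_sum k N (fun a => on_heads (fun x y l =>
  (x0 + y0).-1%:R / (x + y).-1%:R * g a (x + y)%N l))) -expectZ.
apply: le_expect => z /(reachable_cons2 x0_gt0 y0_gt0)[x [y [l [-> x_gt0 y_gt0]]]] /=.
rewrite -mulr_sumr mulrC -[leRHS]mulrA.
by apply: ler_wpM2r; [rewrite divr_ge0 | exact: count_sum_squares].
Qed.

(** One step multiplies the mean of [1 / (D - 1)] by exactly
    [1 - 1 / (2 mass)], since it is [1 / D] with probability [D / (2 mass)]. *)
Lemma expect_inv_heads k x0 y0 l0 : (0 < x0)%N -> (0 < y0)%N ->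
  expect k (on_heads (fun x y _ => (x + y).-1%:R^-1)) [:: x0, y0 & l0] *
    Num.sqrt (mass R [:: x0, y0 & l0] + k%:R) <=
  (x0 + y0).-1%:R^-1 * Num.sqrt (mass R [:: x0, y0 & l0]).
Proof.
move=> x0_gt0 y0_gt0; apply: (@expect_decay _ _ (on_heads _)) => j z.
move=> /(reachable_cons2 x0_gt0 y0_gt0)[x [y [l [-> x_gt0 y_gt0]]]].
rewrite step_cons2 /= ?addSn ?addnS /=; set D := (x + y)%N.
set s := (D + sumn l)%:R.
have D_gt1 : (1 < D)%N by rewrite /D; lia.
have s2 : 2 <= s :> R by rewrite ler_nat; lia.
have D1 : D.-1%:R = D%:R - 1 :> R by rewrite -subn1 natrB // ltnW.
have D2 : D.-1%:R != 0 :> R by rewrite pnatr_eq0; lia.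
have D3 : D%:R != 0 :> R by rewrite pnatr_eq0; lia.
have DE : x%:R = D%:R - y%:R :> R by rewrite /D natrD addrK.
have ME : mass R [:: x, y & l] = s / 2 by rewrite /mass /= addnA.
rewrite ME -mulr_suml -mulr_suml sumr_nth entry_sum_nat.
have sE : s = D%:R + (sumn l)%:R by rewrite /s natrD.
rewrite (_ : _ + _ = D.-1%:R^-1 * (1 - s^-1)); last first.
  rewrite DE D1 (_ : (sumn l)%:R = s - D%:R); last by rewrite sE addrC addKr.
  by field; rewrite -D1 D2 D3 gt_eqF //; lra.
rewrite -mulrA ler_wpM2l ?invr_ge0 // -[leRHS]mul1r.
have s0 : s != 0 by rewrite gt_eqF //; lra. clearbody s.
apply: mul_sqrt_le; [by rewrite subr_ge0 invf_le1; lra|by []|lra|lra|].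
rewrite -subr_ge0 [X in 0 <= X](_ : _ = (3 * s / 2 - 1) / s ^+ 2); last by field.
by rewrite divr_ge0 ?sqr_ge0 //; lra.
Qed.

End Anticoncentration.

(** * Attachment and isomorphism *)

Lemma adj_attach (V : finType) (G : graph V) v (p q : option V) :
  adj (attach G v) p q = match p, q with
    | Some x, Some y => adj G x y
    | Some x, None | None, Some x => x == v
    | None, None => false
    end.
Proof. by rewrite /adj inE; case: p; case: q. Qed.

Lemma card_pred_option (V : finType) (P : pred (option V)) :
  #|P| = (P None + #|[pred x | P (Some x)]|)%N.
Proof.
rewrite (cardD1 None) -(fintype.card_image (ssrfun.Some_inj : injective (@Some V))).
congr (_ + _)%N.
apply: eq_card => -[x|].
  by rewrite fintype.mem_image; [|exact: ssrfun.Some_inj].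
by apply/esym/fintype.imageP => -[].
Qed.

Lemma deg_attach_Some (V : finType) (G : graph V) v x :
  deg (attach G v) (Some x) = (deg G x + (x == v))%N.
Proof.
rewrite /deg card_pred_option /= adj_attach addnC; congr (_ + _)%N.
by apply: eq_card => y; rewrite !inE adj_attach.
Qed.

Lemma deg_attach_None (V : finType) (G : graph V) v :
  deg (attach G v) None = 1%N.
Proof.
rewrite /deg card_pred_option /= adj_attach add0n -(card1 v).
by apply: eq_card => y; rewrite !inE adj_attach.
Qed.

Lemma isoP (V W : finType) (G : graph V) (H : graph W) :
  reflect (exists2 f : V -> W, bijective f & forall u v, adj G u v = adj H (f u) (f v))
          (iso G H).
Proof.
apply: (iffP existsP) => [[f /and3P[/injectiveP fI /eqP cVW /forallP GH]]|[f fB GH]].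
  exists f; first by apply: inj_card_bij => //; rewrite cVW.
  by move=> u v; have /forallP/(_ v)/eqP := GH u.
exists (finfun f); apply/and3P; split.
- by apply/injectiveP => x y; rewrite !ffunE; apply: bij_inj.
- by apply/eqP/bij_eq_card/fB.
- by apply/forallP=> u; apply/forallP => v; rewrite !ffunE GH.
Qed.

Lemma iso_sym (V W : finType) (G : graph V) (H : graph W) : iso G H -> iso H G.
Proof.
move/isoP => [f [g fK gK] GH]; apply/isoP; exists g; first by exists f.
by move=> u v; rewrite GH !gK.
Qed.

Lemma iso_trans (V W U : finType) (G : graph V) (H : graph W) (K : graph U) :
  iso G H -> iso H K -> iso G K.
Proof.
move=> /isoP[f fB GH] /isoP[g gB HK]; apply/isoP; exists (g \o f).
  exact: bij_comp.
by move=> u v; rewrite GH HK.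
Qed.

Lemma unlabel_iso n (V W : finType) (G : graph V) (H : graph W) :
  iso G H -> unlabel n G = unlabel n H.
Proof.
move=> GH; apply/setP => K; rewrite !inE.
by apply/idP/idP; apply: iso_trans => //; apply: iso_sym.
Qed.

(** An unlabeled graph on [n] vertices has a labeling by ['I_n], so isomorphism
    invariants can be read on the representative chosen by [pick]. *)
Lemma unlabel_pick n (V : finType) (G : graph V) : #|V| = n ->
  exists2 H, [pick H in unlabel n G] = Some H & iso G H.
Proof.
move=> Vn; case: pickP => [H|noH]; first by rewrite inE; exists H.
subst n; pose H := [set p : 'I_#|V| * 'I_#|V| | adj G (enum_val p.1) (enum_val p.2)]%SET.
suff: H \in unlabel #|V| G by rewrite noH.
rewrite inE; apply/isoP; exists enum_rank.
  by exists enum_val; [exact: enum_rankK | exact: enum_valK].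
by move=> u v; rewrite /adj inE !enum_rankK.
Qed.

Lemma deg_bij (V W : finType) (G : graph V) (H : graph W) (f : V -> W) v :
  bijective f -> (forall u v, adj G u v = adj H (f u) (f v)) ->
  deg H (f v) = deg G v.
Proof.
move=> fB GH; rewrite /deg -(fintype.card_image (bij_inj fB)).
case: fB => g fK gK; apply: eq_card => w.
rewrite -[w]gK fintype.mem_image ?inE -?GH //; exact: can_inj fK.
Qed.

Lemma iso_attach (V W : finType) (G : graph V) (H : graph W) (f : V -> W) v :
  bijective f -> (forall u v, adj G u v = adj H (f u) (f v)) ->
  iso (attach G v) (attach H (f v)).
Proof.
move=> fB GH; have fI := bij_inj fB; apply/isoP; exists (omap f).
  by case: fB => g fK gK; exists (omap g) => -[x|] //=; rewrite ?fK ?gK.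
by move=> [x|] [y|]; rewrite !adj_attach //= (inj_eq fI).
Qed.

(** * From trees to degree sequences *)

(** Birth order, so that attaching a vertex acts on degree sequences by
    [grow]. *)
Fixpoint vertices (V : finType) (k : nat) : seq (add_vertices V k) :=
  match k return seq (add_vertices V k) with
  | 0 => enum V
  | k'.+1 => rcons (map Some (vertices V k')) None
  end.

Lemma vertices_uniq V k : uniq (vertices V k).
Proof.
elim: k => [|k IHk]; first exact: enum_uniq.
rewrite /= rcons_uniq (map_inj_uniq ssrfun.Some_inj) IHk andbT.
by apply/mapP => -[].
Qed.

Lemma mem_vertices V k x : x \in vertices V k.
Proof.
elim: k x => [|k IHk] x; first exact: mem_enum.
rewrite /= mem_rcons inE; case: x => [x|] //=.
by rewrite mem_map ?IHk //; exact: ssrfun.Some_inj.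
Qed.

Lemma card_add_vertices V k : #|add_vertices V k| = (#|V| + k)%N.
Proof. by elim: k => [|k IHk]; rewrite ?addn0 //= card_option IHk addnS. Qed.

Definition degrees (V : finType) k (G : graph (add_vertices V k)) : seq nat :=
  [seq deg G x | x <- vertices V k].

Local Notation initial_degrees G := (@degrees _ 0 G).

Lemma big_vertices (R : Type) (idx : R) (op : Monoid.com_law idx) V k F :
  \big[op/idx]_(x <- vertices V k) F x = \big[op/idx]_x F x.
Proof.
rewrite big_uniq ?vertices_uniq //; apply: eq_bigl => x; exact: mem_vertices.
Qed.

Lemma incr_nth_map (T : eqType) (d : T -> nat) s v : uniq s -> v \in s ->
  incr_nth [seq d x | x <- s] (index v s) = [seq (d x + (x == v))%N | x <- s].
Proof.
elim: s => //= x s IHs /andP[xs us]; rewrite inE [v == x]eq_sym.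
have [<-|xv] := eqVneq x v => /= vs; last by rewrite addn0 IHs.
rewrite addn1; congr cons; apply/eq_in_map => y ys; case: eqP => [yx|]; last by rewrite addn0.
by rewrite yx (negPf xs) in ys.
Qed.

Lemma degrees_attach V k (G : graph (add_vertices V k)) v :
  @degrees V k.+1 (attach G v) = grow (degrees G) (index v (vertices V k)).
Proof.
rewrite /degrees /grow map_rcons deg_attach_None incr_nth_map ?vertices_uniq ?mem_vertices //.
by rewrite -map_comp; congr rcons; apply: eq_map => x; exact: deg_attach_Some.
Qed.

Lemma entry_sum_degrees (R : realFieldType) V k (G : graph (add_vertices V k)) (f : nat -> R) :
  entry_sum f (degrees G) = \sum_x f (deg G x).
Proof. by rewrite /entry_sum big_map big_vertices. Qed.

Lemma sumn_degrees V k (G : graph (add_vertices V k)) :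
  sumn (degrees G) = (\sum_x deg G x)%N.
Proof. by rewrite sumnE big_map big_vertices. Qed.

Lemma step_degrees (R : realFieldType) V k (G : graph (add_vertices V k)) (h : seq nat -> R) :
  step h (degrees G) =
  \sum_v (deg G v)%:R / (\sum_u deg G u)%:R * h (@degrees V k.+1 (attach G v)).
Proof.
rewrite -big_vertices /step sumn_degrees size_map; set t := (\sum_u deg G u)%N.
under [RHS]eq_bigr do rewrite degrees_attach.
case E : (vertices V k) => [|x0 s]; first by rewrite big_ord0 big_nil.
rewrite -E (big_nth x0) big_mkord; apply: eq_bigr => i _.
by rewrite (nth_map x0) // index_uniq ?vertices_uniq.
Qed.

(** * Laws of preferential attachment trees *)

Section PreferentialAttachment.
Variable R : realType.

Lemma pa_step_ge0 (V : finType) (G : graph V) G' : 0 <= pa_step R G G'.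
Proof. by apply: sumr_ge0 => v _; rewrite divr_ge0. Qed.

Lemma pa_steps_ge0 (V : finType) (S : graph V) k (G : graph (add_vertices V k)) :
  0 <= pa_steps R S G.
Proof.
elim: k G => [|k IHk] G //=; apply: sumr_ge0 => H _.
by rewrite mulr_ge0 ?pa_step_ge0.
Qed.

Lemma pa_stepsS (V : finType) (S : graph V) k (G' : graph (add_vertices V k.+1)) :
  pa_steps R S G' =
  \sum_(G : graph (add_vertices V k)) pa_steps R S G * pa_step R G G'.
Proof. by []. Qed.

Lemma sum_pa_stepsS (V : finType) (S : graph V) k (f : graph (add_vertices V k.+1) -> R) :
  \sum_G pa_steps R S G * f G =
  \sum_(G : graph (add_vertices V k)) pa_steps R S G *
    \sum_v (deg G v)%:R / (\sum_u deg G u)%:R * f (attach G v).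
Proof.
under eq_bigr do rewrite pa_stepsS mulr_suml.
rewrite exchange_big; apply: eq_bigr => G _ /=.
under eq_bigr do rewrite -mulrA; rewrite -mulr_sumr; congr (_ * _).
rewrite /pa_step; under [LHS]eq_bigr do rewrite mulr_suml.
rewrite (exchange_big_dep predT) //=; apply: eq_bigr => v _.
by rewrite (eq_bigl (pred1 (attach G v))) ?big_pred1_eq // => H; rewrite /= eq_sym.
Qed.

(** The degree sequence is itself Markov, which reduces means over random trees
    to the transition operator on lists. *)
Lemma pa_steps_degrees (V : finType) (S : graph V) k (h : seq nat -> R) :
  \sum_(G : graph (add_vertices V k)) pa_steps R S G * h (degrees G) =
  expect k h (initial_degrees S).
Proof.
elim: k h => [|k IHk] h.
  rewrite /= (bigD1 S) //= eqxx mul1r big1 ?addr0 // => G /negPf ->.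
  by rewrite mul0r.
rewrite expectSr -IHk (sum_pa_stepsS S (fun G => h (@degrees V k.+1 G))).
by apply: eq_bigr => G _; rewrite step_degrees.
Qed.

Lemma sum_PA n (V : finType) (S : graph V) (f : {set graph 'I_n} -> R) :
  \sum_c PA R n S c * f c =
  \sum_(G : graph (add_vertices V (n - #|V|))) pa_steps R S G * f (unlabel n G).
Proof.
rewrite /PA; under eq_bigr do rewrite mulr_suml.
rewrite (exchange_big_dep predT) //=; apply: eq_bigr => G _.
by rewrite (eq_bigl (pred1 (unlabel n G))) ?big_pred1_eq // => c; rewrite /= eq_sym.
Qed.

Lemma PA_ge0 n (V : finType) (S : graph V) c : 0 <= PA R n S c.
Proof. by apply: sumr_ge0 => G _; exact: pa_steps_ge0. Qed.

Lemma PA_mass n (V : finType) (S : graph V) : (0 < \sum_v deg S v)%N ->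
  \sum_c PA R n S c = 1.
Proof.
move=> S0; have := sum_PA S (fun=> 1 : R) (n := n).
under eq_bigr do rewrite mulr1; move=> ->.
rewrite (pa_steps_degrees S _ (fun=> 1)) expect_cst //.
by rewrite sumn_degrees.
Qed.

Definition class_squares n (c : {set graph 'I_n}) : R :=
  if [pick H in c] is Some H then \sum_v (deg H v)%:R ^+ 2 else 0.

(** The step of preferential attachment, as a kernel on unlabeled graphs. *)
Definition class_step n (c : {set graph 'I_n}) (c' : {set graph 'I_n.+1}) : R :=
  if [pick H in c] is Some H then
    \sum_(v | unlabel n.+1 (attach H v) == c') (deg H v)%:R / (\sum_u deg H u)%:R
  else 0.

Lemma sum_deg_bij (V W : finType) (G : graph V) (H : graph W) (f : V -> W) :
  bijective f -> (forall u v, adj G u v = adj H (f u) (f v)) ->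
  (\sum_u deg H u = \sum_u deg G u)%N.
Proof.
move=> fB GH; rewrite (reindex f) /=; last exact: onW_bij.
by apply: eq_bigr => u _; exact: deg_bij.
Qed.

Lemma class_squares_unlabel n (V : finType) (G : graph V) : #|V| = n ->
  class_squares (unlabel n G) = \sum_v (deg G v)%:R ^+ 2.
Proof.
move=> Vn; have [H pickH /isoP[f fB GH]] := unlabel_pick G Vn.
rewrite /class_squares pickH (reindex f) /=; last exact: onW_bij.
by apply: eq_bigr => v _; rewrite (deg_bij v fB GH).
Qed.

(** Isomorphic graphs have isomorphic attachments with equal weights, so the
    choice of the representative is immaterial. *)
Lemma class_step_unlabel n (V : finType) (G : graph V) c' : #|V| = n ->
  class_step (unlabel n G) c' =
  \sum_(v | unlabel n.+1 (attach G v) == c') (deg G v)%:R / (\sum_u deg G u)%:R.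
Proof.
move=> Vn; have [H pickH /isoP[f fB GH]] := unlabel_pick G Vn.
rewrite /class_step pickH (reindex f) /=; last exact: onW_bij.
rewrite (sum_deg_bij fB GH); apply: eq_big => [v|v _]; last by rewrite (deg_bij v fB GH).
by rewrite (unlabel_iso _ (iso_attach v fB GH)).
Qed.

Lemma class_step_ge0 n (c : {set graph 'I_n}) c' : 0 <= class_step c c'.
Proof.
rewrite /class_step; case: pickP => // H _.
by apply: sumr_ge0 => v _; rewrite divr_ge0.
Qed.

Lemma class_step_le1 n (c : {set graph 'I_n}) : \sum_c' class_step c c' <= 1.
Proof.
rewrite /class_step; case: pickP => [H _|_]; last by rewrite big1.
rewrite (exchange_big_dep predT) //=.
under eq_bigr => v _.
  rewrite (eq_bigl (pred1 (unlabel n.+1 (attach H v)))); last by move=> c'; rewrite /= eq_sym.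
  rewrite big_pred1_eq; over.
rewrite -mulr_suml -natr_sum; case: (posnP (\sum_u deg H u)) => [->|s0]; first by rewrite mul0r.
by rewrite divff // pnatr_eq0 -lt0n.
Qed.

Lemma PA_succ n (V : finType) (S : graph V) c' : (#|V| <= n)%N ->
  PA R n.+1 S c' = \sum_c PA R n S c * class_step c c'.
Proof.
move=> Vn; rewrite (sum_PA S (fun c => class_step c c')) /PA subSn //.
rewrite big_mkcond /=.
have := sum_pa_stepsS S (fun G : graph (add_vertices V (n - #|V|).+1) =>
  (unlabel n.+1 G == c')%:R : R).
rewrite (eq_bigr (fun G => if unlabel n.+1 G == c' then pa_steps R S G else 0))
  => [->|G _]; last first.
  by rewrite mulr_natr mulrb.
apply: eq_bigr => G _; rewrite class_step_unlabel; last first.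
  by rewrite card_add_vertices subnKC.
by congr (_ * _); rewrite [RHS]big_mkcond; apply: eq_bigr => v _; rewrite mulr_natr mulrb.
Qed.

Lemma sum_PA_squares n (V : finType) (S : graph V) (f : R -> R) : (#|V| <= n)%N ->
  \sum_c PA R n S c * f (class_squares c) =
  expect (n - #|V|) (fun z => f (squares R z)) (initial_degrees S).
Proof.
move=> Vn; rewrite (sum_PA S (fun c => f (class_squares c))).
rewrite -(pa_steps_degrees S _ (fun z => f (squares R z))).
apply: eq_bigr => G _; rewrite class_squares_unlabel ?card_add_vertices ?subnKC //.
by rewrite /squares entry_sum_degrees.
Qed.

End PreferentialAttachment.

(** * Total variation distance *)

Section TotalVariation.
Variables (R : realType) (X : finType).
Implicit Types P Q : X -> R.

Lemma TV_ge P Q (A : {set X}) : `|\sum_(x in A) P x - \sum_(x in A) Q x| <= TV P Q.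
Proof.
apply: ub_le_sup; last by exists A.
exists (\sum_x `|P x - Q x|) => _ [B _ <-].
rewrite -sumrB; apply: le_trans (ler_norm_sum _ _ _) _.
by rewrite big_mkcond; apply: ler_sum => x _; case: ifP.
Qed.

Lemma TV_le P Q b :
  (forall A : {set X}, `|\sum_(x in A) P x - \sum_(x in A) Q x| <= b) -> TV P Q <= b.
Proof.
move=> PQb; apply: ge_sup; last by move=> _ [B _ <-].
by exists `|\sum_(x in finset.set0) P x - \sum_(x in finset.set0) Q x|, finset.set0.
Qed.

Lemma TV_ge0 P Q : 0 <= TV P Q.
Proof. exact: le_trans (normr_ge0 _) (TV_ge P Q finset.set0). Qed.

(** Among tests with values in [0, 1], the indicator of [Q <= P] is optimal. *)
Lemma TV_test P Q (f : X -> R) : (forall x, 0 <= f x <= 1) ->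
  \sum_x (P x - Q x) * f x <= TV P Q.
Proof.
move=> f01; pose A := [set x | Q x <= P x]%SET.
apply: le_trans (le_trans (ler_norm _) (TV_ge P Q A)).
rewrite -sumrB [leRHS]big_mkcond; apply: ler_sum => x _; rewrite inE.
have /andP[f0 f1] := f01 x.
by case: ifPn => [|]; rewrite -?ltNge => PQ; nra.
Qed.
End TotalVariation.

Lemma TVC (R : realType) (X : finType) (P Q : X -> R) : TV P Q = TV Q P.
Proof.
by rewrite /TV; congr sup; apply/seteqP; split=> _ [A _ <-]; exists A; rewrite // distrC.
Qed.

(** Data processing: pulling an event back along the kernel gives a test with
    values in [0, 1]. *)
Lemma TV_kernel (R : realType) (X Y : finType) (P Q : X -> R) (K : X -> Y -> R) :
  (forall x y, 0 <= K x y) -> (forall x, \sum_y K x y <= 1) ->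
  TV (fun y => \sum_x P x * K x y) (fun y => \sum_x Q x * K x y) <= TV P Q.
Proof.
move=> K0 K1; apply: TV_le => A.
pose f x := \sum_(y in A) K x y.
have f01 x : 0 <= f x <= 1.
  rewrite sumr_ge0 //=; apply: le_trans (K1 x).
  by rewrite /f big_mkcond; apply: ler_sum => y _; case: ifP.
have E (P' : X -> R) : \sum_(y in A) \sum_x P' x * K x y = \sum_x P' x * f x.
  by rewrite exchange_big; apply: eq_bigr => x _; rewrite mulr_sumr.
rewrite !E ler_norml -[X in X && _]lerN2 opprK opprB -!sumrB.
apply/andP; split.
  rewrite TVC; apply: le_trans (TV_test Q P f01).
  by rewrite le_eqVlt; apply/orP; left; apply/eqP/eq_bigr => x _; rewrite mulrBl.
apply: le_trans (TV_test P Q f01).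
by rewrite le_eqVlt; apply/orP; left; apply/eqP/eq_bigr => x _; rewrite mulrBl.
Qed.

(** * The test on pairs of trees *)

Lemma expect_affine (R : realFieldType) k a b (h : seq nat -> R) l : (0 < sumn l)%N ->
  expect k (fun z => a + b * h z) l = a + b * expect k h l.
Proof. by move=> l0; rewrite (expectD k (fun=> a)) expectZ expect_cst. Qed.

(** Chebyshev: both values lie near the common center of [concentration], and
    [(y - z) ^ 2 <= 2 (y - c) ^ 2 + 2 (z - c) ^ 2]. *)
Lemma expect_pair_close (R : realFieldType) k l (d : R) : (0 < sumn l)%N -> 0 < d ->
  1 - 4 / d ^+ 2 * slack R l <=
  expect k (fun y => expect k (fun z =>
    (`|squares R y - squares R z| <= d * (mass R l + k%:R))%R%:R) l) l.
Proof.
move=> l0 d0; have [c Hc] := concentration R k l0.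
pose Y z := squares R z / mass R z; pose v := expect k (fun z => (Y z - c) ^+ 2) l.
have d20 : 0 < d ^+ 2 by rewrite exprn_gt0.
have b0 : 0 <= 4 / d ^+ 2 by rewrite divr_ge0 // ltW.
apply: (@le_trans _ _ (1 - 4 / d ^+ 2 * v)).
  by rewrite lerD2l lerN2; apply: ler_wpM2l.
apply: (@le_trans _ _ (expect k (fun y =>
    (1 - 2 / d ^+ 2 * v) + - (2 / d ^+ 2) * (Y y - c) ^+ 2) l)).
  rewrite expect_affine // -/v le_eqVlt; apply/orP; left; apply/eqP.
  by field; rewrite gt_eqF.
apply: le_expect => y ly.
apply: (@le_trans _ _ (expect k (fun z =>
    (1 - 2 / d ^+ 2 * (Y y - c) ^+ 2) + - (2 / d ^+ 2) * (Y z - c) ^+ 2) l)).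
  by rewrite expect_affine // -/v le_eqVlt; apply/orP; left; apply/eqP; ring.
apply: le_expect => z lz.
have M0 : 0 < mass R l + k%:R by rewrite ltr_wpDr ?mass_gt0.
have [_|] := boolP (`|_| <= _).
  rewrite mulNr -addrA -opprD -mulrDr gerDl oppr_le0.
  by rewrite mulr_ge0 ?addr_ge0 ?sqr_ge0 // divr_ge0 // ltW.
rewrite -ltNge => far.
have : d < `|Y y - Y z|.
  rewrite /Y (mass_reachable R ly) (mass_reachable R lz) -mulrBl normrM.
  by rewrite (ger0_norm (_ : 0 <= (mass R l + k%:R)^-1)) ?invr_ge0 ?(ltW M0) // ltr_pdivlMr.
move=> dY; have {}dY : d ^+ 2 <= (Y y - Y z) ^+ 2.
  by rewrite -[leRHS]real_normK ?num_real // lerXn2r ?nnegrE ?(ltW d0) // ltW.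
rewrite (_ : false%:R = 0 :> R) // -subr_ge0.
rewrite [X in 0 <= X](_ : _ = (2 * ((Y y - c) ^+ 2 + (Y z - c) ^+ 2) - d ^+ 2) / d ^+ 2).
  rewrite divr_ge0 ?(ltW d20) //.
  have := sqr_ge0 ((Y y - c) + (Y z - c)); nra.
by field; rewrite gt_eqF.
Qed.

Section TestOnPairs.
Variable R : realType.

(** The total degree is deterministic: the mean of the indicator of any other
    value vanishes. *)
Lemma pa_steps_support (V : finType) (S : graph V) k (G : graph (add_vertices V k)) :
  pa_steps R S G != 0 -> sumn (degrees G) = (sumn (initial_degrees S) + k.*2)%N.
Proof.
move=> pG; apply/eqP; apply: contraNT pG => dG.
have := pa_steps_degrees S k (fun z => (sumn z != sumn (initial_degrees S) + k.*2)%N%:R : R).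
rewrite (@eq_expect R k _ (fun=> 0 * 0)); last first.
  by move=> z /reachable_sumn ->; rewrite eqxx mulr0.
rewrite expectZ mul0r => /psumr_eq0P => /(_ _ G isT); rewrite dG mulr1 => ->//.
by move=> H _; rewrite mulr_ge0 ?pa_steps_ge0.
Qed.

Definition close_pairs n (w : R) : {set {set graph 'I_n} * {set graph 'I_n}} :=
  [set c | `|class_squares R c.1 - class_squares R c.2| <= w]%SET.

Lemma sum_close n (V : finType) (S : graph V) w : (#|V| <= n)%N ->
  \sum_(c in close_pairs n w) PA R n S c.1 * PA R n S c.2 =
  expect (n - #|V|) (fun y => expect (n - #|V|) (fun z =>
    (`|squares R y - squares R z| <= w)%R%:R) (initial_degrees S)) (initial_degrees S).
Proof.
move=> Vn; rewrite -(sum_PA_squares S (fun q => expect (n - #|V|) (fun z =>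
    (`|q - squares R z| <= w)%R%:R) (initial_degrees S)) Vn).
under [RHS]eq_bigr => c _ do
  rewrite -(sum_PA_squares S (fun q => (`|class_squares R c - q| <= w)%R%:R) Vn) mulr_sumr.
rewrite pair_big /= big_mkcond; apply: eq_bigr => -[c1 c2] _.
by rewrite inE /= mulrA; case: ifP => _; rewrite ?mulr1 ?mulr0.
Qed.

Lemma PA2_succ n (V : finType) (S : graph V) y : (#|V| <= n)%N ->
  PA R n.+1 S y.1 * PA R n.+1 S y.2 =
  \sum_x PA R n S x.1 * PA R n S x.2 * (class_step R x.1 y.1 * class_step R x.2 y.2).
Proof.
move=> Vn; rewrite !PA_succ // big_distrl /=.
under [LHS]eq_bigr do rewrite mulr_sumr.
by rewrite pair_big /=; apply: eq_bigr => -[x1 x2] _ /=; rewrite mulrACA.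
Qed.

(** Both laws at size [n + 1] are images of those at size [n] under the product
    of two copies of the step kernel. *)
Lemma TV_CPA_succ n t (V : finType) (S : graph V) : (#|V| <= t <= n)%N ->
  TV (CPA R n.+1 t S) (PA2 R n.+1 S) <= TV (CPA R n t S) (PA2 R n S).
Proof.
move=> /andP[Vt tn].
pose K (x : {set graph 'I_n} * {set graph 'I_n})
       (y : {set graph 'I_n.+1} * {set graph 'I_n.+1}) :=
  class_step R x.1 y.1 * class_step R x.2 y.2.
rewrite (_ : CPA R n.+1 t S = fun y => \sum_x CPA R n t S x * K x y); last first.
  apply/funext => y; rewrite /CPA; under [RHS]eq_bigr do rewrite mulr_suml.
  rewrite exchange_big; apply: eq_bigr => T _ /=.
  rewrite PA2_succ ?card_add_vertices ?subnKC // mulr_sumr.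
  by apply: eq_bigr => x _; rewrite -!mulrA.
rewrite (_ : PA2 R n.+1 S = fun y => \sum_x PA2 R n S x * K x y); last first.
  by apply/funext => y; rewrite /PA2 PA2_succ // (leq_trans Vt).
apply: TV_kernel => [x y|x]; first by rewrite mulr_ge0 ?class_step_ge0.
rewrite -(pair_bigA _ (fun y1 y2 => class_step R x.1 y1 * class_step R x.2 y2)) /=.
under eq_bigr do rewrite -mulr_sumr; rewrite -mulr_suml.
by rewrite mulr_ile1 ?class_step_le1 // sumr_ge0 // => *; exact: class_step_ge0.
Qed.

Lemma TV_le1 (X : finType) (P Q : X -> R) : (forall x, 0 <= P x) -> (forall x, 0 <= Q x) ->
  \sum_x P x = 1 -> \sum_x Q x = 1 -> TV P Q <= 1.
Proof.
have bd (P' : X -> R) (A : {set X}) : (forall x, 0 <= P' x) -> \sum_x P' x = 1 ->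
    0 <= \sum_(x in A) P' x <= 1.
  move=> P0 <-; rewrite sumr_ge0 //=.
  by rewrite big_mkcond; apply: ler_sum => x _; case: ifP.
move=> P0 Q0 P1 Q1; apply: TV_le => A; rewrite ler_norml.
have /andP[? ?] := bd _ A P0 P1; have /andP[? ?] := bd _ A Q0 Q1.
by apply/andP; split; lra.
Qed.

Lemma PA2_mass n (V : finType) (S : graph V) : (0 < \sum_v deg S v)%N ->
  \sum_c PA R n S c.1 * PA R n S c.2 = 1.
Proof.
move=> S0; rewrite -(pair_bigA _ (fun c1 c2 => PA R n S c1 * PA R n S c2)) /=.
by under eq_bigr do rewrite -mulr_sumr PA_mass // mulr1; rewrite PA_mass.
Qed.

Lemma pa_steps_mass (V : finType) (S : graph V) k : (0 < \sum_v deg S v)%N ->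
  \sum_(G : graph (add_vertices V k)) pa_steps R S G = 1.
Proof.
move=> S0; rewrite -[RHS](@expect_cst R k 1 (initial_degrees S)) ?sumn_degrees //.
rewrite -(pa_steps_degrees S k (fun=> 1)); by apply: eq_bigr => G _; rewrite mulr1.
Qed.

Lemma support_deg_gt0 (V : finType) (S : graph V) k (T : graph (add_vertices V k)) :
  (0 < \sum_v deg S v)%N -> pa_steps R S T != 0 -> (0 < \sum_v deg T v)%N.
Proof.
move=> S0 /pa_steps_support; rewrite !sumn_degrees => ->.
by rewrite addn_gt0 S0.
Qed.

Lemma CPA_mass n t (V : finType) (S : graph V) : (0 < \sum_v deg S v)%N ->
  \sum_c CPA R n t S c = 1.
Proof.
move=> S0; rewrite /CPA exchange_big /= -(pa_steps_mass (t - #|V|) S0).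
apply: eq_bigr => T _; rewrite -mulr_sumr.
have [->|pT] := eqVneq (pa_steps R S T) 0; first by rewrite mul0r.
by rewrite PA2_mass ?mulr1 //; exact: support_deg_gt0 pT.
Qed.

Lemma TV_CPA_le1 n t (V : finType) (S : graph V) : (0 < \sum_v deg S v)%N ->
  TV (CPA R n t S) (PA2 R n S) <= 1.
Proof.
move=> S0; apply: TV_le1; rewrite ?CPA_mass ?PA2_mass // => c.
  by apply: sumr_ge0 => T _; rewrite !mulr_ge0 ?pa_steps_ge0 ?PA_ge0.
by rewrite mulr_ge0 ?PA_ge0.
Qed.

(** [expect_pair_close] conditionally on the common tree, then averaged over it.
    The slack is a symmetric function of the degrees, hence indifferent to the
    order in which the vertices of the common tree are listed. *)
Lemma CPA_close n t (V : finType) (S : graph V) (d : R) :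
  (#|V| <= t <= n)%N -> (0 < \sum_v deg S v)%N -> 0 < d ->
  1 - 4 / d ^+ 2 * expect (t - #|V|) (slack R) (initial_degrees S) <=
  \sum_(c in close_pairs n (d * (mass R (initial_degrees S) + (n - #|V|)%:R))) CPA R n t S c.
Proof.
move=> /andP[Vt tn] S0 d0; rewrite /CPA exchange_big /=.
under [leRHS]eq_bigr do rewrite -mulr_sumr.
rewrite -mulNr -expect_affine ?sumn_degrees //.
rewrite -(pa_steps_degrees S _ (fun z => 1 + - (4 / d ^+ 2) * slack R z)).
apply: ler_sum => T _; have [->|pT] := eqVneq (pa_steps R S T) 0; first by rewrite !mul0r.
apply: ler_wpM2l; first exact: pa_steps_ge0.
rewrite sum_close ?card_add_vertices ?subnKC //.
have TE (f : nat -> R) : entry_sum f (initial_degrees T) = entry_sum f (degrees T).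
  by rewrite !entry_sum_degrees.
have sE : sumn (initial_degrees T) = sumn (degrees T) by rewrite !sumn_degrees.
have TM : mass R (initial_degrees T) = mass R (degrees T) by rewrite /mass sE.
have -> : slack R (degrees T) = slack R (initial_degrees T).
  by rewrite /slack /potential /cubes TE TM.
rewrite mulNr.
have -> : mass R (initial_degrees S) + (n - #|V|)%:R = mass R (initial_degrees T) + (n - t)%:R.
  rewrite TM /mass (pa_steps_support pT) -muln2 natrD natrM mulrDl mulfK ?pnatr_eq0 //.
  by rewrite -addrA -natrD addnC addnBA // subnK.
by apply: expect_pair_close => //; rewrite sE sumn_degrees; exact: support_deg_gt0 pT.
Qed.

(** Freeze one tree: its sum of squares is the center of a window which the
    other one must hit. *)
Lemma PA2_close n (V : finType) (S : graph V) x0 y0 l0 (e : R) : (#|V| <= n)%N ->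
  initial_degrees S = [:: x0, y0 & l0] -> (0 < x0)%N -> (0 < y0)%N -> 0 <= e ->
  \sum_(c in close_pairs n (e ^+ 2 * (mass R (initial_degrees S) + (n - #|V|)%:R))) PA2 R n S c <=
  2 * Num.sqrt (mass R (initial_degrees S)) *
    (e + (Num.sqrt (mass R (initial_degrees S) + (n - #|V|)%:R))^-1).
Proof.
move=> Vn dS x0_gt0 y0_gt0 e0; rewrite sum_close // dS.
set l := [:: x0, y0 & l0]; set k := (n - #|V|)%N; set M := mass R l.
have l_gt0 : (0 < sumn l)%N by rewrite /= addn_gt0 x0_gt0.
have M0 : 0 < M by exact: mass_gt0.
have Mk0 : 0 < M + k%:R by rewrite ltr_wpDr.
have w0 : 0 <= e ^+ 2 * (M + k%:R) by rewrite mulr_ge0 ?sqr_ge0 // ltW.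
pose E := expect k (on_heads (fun x y _ => (x + y).-1%:R^-1 : R)) l.
rewrite -[leRHS](@expect_cst R k _ l) //; apply: le_expect => y _.
rewrite (@eq_expect R k _ (fun z =>
    (`|squares R z - squares R y| <= e ^+ 2 * (M + k%:R))%R%:R)); last first.
  by move=> z _; rewrite distrC.
apply: le_trans (anticoncentration k l0 (squares R y) x0_gt0 y0_gt0 w0) _.
rewrite -/l -/E sqrtrM ?sqr_ge0 // sqrtr_sqr (ger0_norm e0).
have := @expect_inv_heads R k x0 y0 l0 x0_gt0 y0_gt0; rewrite -/l -/E -/M => HE.
have s0 : 0 < (x0 + y0).-1%:R :> R by rewrite ltr0n; lia.
set r := Num.sqrt (M + k%:R) in HE *.
have r0 : 0 < r by rewrite sqrtr_gt0.
have -> : 2 * (e * r + 1) * (x0 + y0).-1%:R * E = 2 * (e + r^-1) * ((x0 + y0).-1%:R * (E * r)).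
  by field; rewrite gt_eqF.
rewrite [leRHS]mulrAC; apply: ler_wpM2l.
  by rewrite mulr_ge0 // addr_ge0 // invr_ge0 ltW.
by rewrite -ler_pdivlMl.
Qed.

Lemma near_le_sqrt (a m e : R) : 0 < e -> 0 <= m ->
  \forall k \near \oo, a <= e * Num.sqrt (m + k%:R).
Proof.
move=> e0 m0; near=> k; have [a0|a0] := ltP a 0.
  by rewrite (le_trans (ltW a0)) // mulr_ge0 ?sqrtr_ge0 // ltW.
rewrite -ler_pdivrMl // -[leLHS]ger0_norm ?mulr_ge0 ?invr_ge0 ?(ltW e0) //.
rewrite -sqrtr_sqr ler_wsqrtr //.
apply: (@le_trans _ _ k%:R); last by rewrite lerDr.
by near: k; exact: nbhs_infty_ger.
Unshelve. all: by end_near. Qed.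

Lemma tree_deg_gt0 (V : finType) (S : graph V) : is_tree S -> (2 <= #|V|)%N ->
  forall v, (0 < deg S v)%N.
Proof.
move=> treeS V2 v; have [u uv] : exists u, u != v.
  have : (0 < #|predC1 v|)%N by rewrite cardC1; lia.
  by case/card_gt0P => u; exists u.
have /connectP[[|w p] /= vp uE] := tree_connected treeS v u; first by rewrite uE eqxx in uv.
by apply/card_gt0P; exists w; move: vp => /andP[].
Qed.

End TestOnPairs.

(** * The theorem *)

Lemma TV_CPA_ge (R : realType) n t (V : finType) (S : graph V) (e : R) :
  is_tree S -> (2 <= #|V|)%N -> (#|V| <= t <= n)%N -> 0 < e ->
  1 - 4 / e ^+ 4 * (slack R (initial_degrees S) * Num.sqrt (mass R (initial_degrees S)))
      / Num.sqrt (mass R (initial_degrees S) + (t - #|V|)%:R)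
    - 2 * Num.sqrt (mass R (initial_degrees S)) *
      (e + (Num.sqrt (mass R (initial_degrees S) + (n - #|V|)%:R))^-1)
  <= TV (CPA R n t S) (PA2 R n S).
Proof.
move=> treeS V2 /andP[Vt tn] e0; set M := mass R _.
have deg0 := tree_deg_gt0 treeS V2.
have [x0 [y0 [l0 [dS x0_gt0 y0_gt0]]]] : exists x y l,
    [/\ initial_degrees S = [:: x, y & l], (0 < x)%N & (0 < y)%N].
  rewrite /degrees /=; move: V2; rewrite cardE.
  by case: (enum V) => [|u [|v s]] //= _; exists (deg S u), (deg S v), [seq deg S x | x <- s].
have S0 : (0 < \sum_v deg S v)%N by rewrite -(sumn_degrees (k := 0)) dS /= addn_gt0 x0_gt0.
have M0 : 0 < M by rewrite mass_gt0 // sumn_degrees.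
pose A := close_pairs n (e ^+ 2 * (M + (n - #|V|)%:R)).
have e20 : 0 < e ^+ 2 by rewrite exprn_gt0.
apply: le_trans (le_trans (ler_norm _) (TV_ge _ _ A)); apply: lerB; last first.
  by apply: PA2_close dS _ _ _ => //; [exact: leq_trans tn | exact: ltW].
apply: le_trans (CPA_close _ S0 e20); last by rewrite Vt.
rewrite -exprM lerD2l lerN2 -[leRHS]mulrA ler_wpM2l ?divr_ge0 ?exprn_ge0 ?(ltW e0) //.
by rewrite ler_pdivlMr ?sqrtr_gt0 ?ltr_wpDr // expect_slack // sumn_degrees.
Qed.

Theorem theorem1p7 (R : realType) (V : finType) (S : graph V)
    (treeS : is_tree S) (cardV : (2 <= #|V|)%N) :
  (forall t : nat, (#|V| <= t)%N ->
     cvgn (fun n : nat => TV (CPA R n t S) (PA2 R n S))) /\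
  (fun t : nat => limn (fun n : nat => TV (CPA R n t S) (PA2 R n S))) @ \oo
    --> (1 : R).
Proof.
have cvgTV t : (#|V| <= t)%N -> cvgn (fun n : nat => TV (CPA R n t S) (PA2 R n S)).
  move=> Vt; set u := fun n : nat => _.
  have : cvgn [sequence u (n + t)%N]_n.
    apply: nonincreasing_is_cvgn.
      apply/nonincreasing_seqP => n; rewrite /= addSn; apply: TV_CPA_succ.
      by rewrite Vt leq_addl.
    by exists 0 => _ [n _ <-]; exact: TV_ge0.
  by move=> /cvg_ex[l ul]; apply/cvg_ex; exists l; rewrite -(cvg_shiftn t).
split=> //; apply/cvgrPdist_le => eps eps0.
set M := mass R (initial_degrees S).
have S0 : (0 < \sum_v deg S v)%N.
  have [v _] : exists v, v \in V by apply/card_gt0P; exact: leq_trans cardV.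
  by rewrite (bigD1 v) //= addn_gt0 (tree_deg_gt0 treeS cardV).
have M0 : 0 < M by rewrite mass_gt0 // sumn_degrees.
have r0 : 0 < Num.sqrt M by rewrite sqrtr_gt0.
(* The error of [TV_CPA_ge] splits into three terms. This value of [e] makes the
   one depending on [e] alone equal to [eps / 3]; [t] and [n] in turn
   make the other two at most [eps / 3]. *)
pose e := eps / (6 * Num.sqrt M).
have e0 : 0 < e by rewrite divr_gt0 // mulr_gt0.
have eps30 : 0 < eps / 3 by rewrite divr_gt0.
have [N1 _ H1] := near_le_sqrt
  (4 / e ^+ 4 * (slack R (initial_degrees S) * Num.sqrt M)) eps30 (ltW M0).
have [N2 _ H2] := near_le_sqrt (2 * Num.sqrt M) eps30 (ltW M0).
near=> t.
have Vt : (#|V| <= t)%N by near: t; exact: nbhs_infty_ge.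
have N1t : (N1 <= t - #|V|)%N.
  by rewrite leq_subRL // addnC; near: t; exact: nbhs_infty_ge.
have lim_le1 : limn (fun n : nat => TV (CPA R n t S) (PA2 R n S)) <= 1.
  by apply: limr_le; [exact: cvgTV | near=> n; exact: TV_CPA_le1].
rewrite ger0_norm ?subr_ge0 // lerBlDr -lerBlDl.
apply: limr_ge; first exact: cvgTV.
near=> n.
have tn : (t <= n)%N by near: n; exact: nbhs_infty_ge.
have N2n : (N2 <= n - #|V|)%N.
  rewrite leq_subRL ?(leq_trans Vt) // addnC; near: n; exact: nbhs_infty_ge.
apply: le_trans (TV_CPA_ge treeS cardV _ e0); last by rewrite Vt.
rewrite -/M.
have {}H1 := H1 _ N1t; have {}H2 := H2 _ N2n.
have Mk0 k : 0 < Num.sqrt (M + k%:R) by rewrite sqrtr_gt0 ltr_wpDr.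
have {}H1 : 4 / e ^+ 4 * (slack R (initial_degrees S) * Num.sqrt M) /
    Num.sqrt (M + (t - #|V|)%:R) <= eps / 3 by rewrite ler_pdivrMr.
have {}H2 : 2 * Num.sqrt M / Num.sqrt (M + (n - #|V|)%:R) <= eps / 3.
  by rewrite ler_pdivrMr.
have H3 : 2 * Num.sqrt M * e = eps / 3 by rewrite /e; field; rewrite gt_eqF.
rewrite [2 * _ * (e + _)]mulrDr H3; lra.
Unshelve. all: by end_near. Qed.
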